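(* Let $\Delta_v$ be an interior cell in $\mathbb{R}^n$ around the vertex $v$, and let $r,\rho$ be integers with $0 \le r \le \rho$. Then $S^r(\Delta_v) \subset C^\rho(\Delta_v)$ if and only if the polynomial spline space $S_\rho^r(\Delta_v)$ is degenerate, i.e. $S_\rho^r(\Delta_v) = \Pi_\rho$.
   Context: A mesh $\Delta$ in $\mathbb{R}^n$ ($n\ge 1$) is a finite set of (closed, nondegenerate) $n$-simplices such that any two distinct $T_1,T_2\in\Delta$ have intersection that is either empty or a common $k$-face, $0\le k\le n-1$. For a vertex $v$ of $\Delta$, the cell $\Delta_v$ is the set of $n$-simplices of $\Delta$ that have $v$ as a vertex, and $\Omega_v=\bigcup\{T:T\in\Delta_v\}$. The cell $\Delta_v$ is an interior cell if $v$ lies in the interior of $\Omega_v$. A spline on $\Delta_v$ is a family $\sigma=\{(U_T,f_T): T\in\Delta_v\}$ with, for each $T$, $U_T\subset\mathbb{R}^n$ open, $T\subset U_T$ and $f_T\in C^\infty(U_T)$ real-valued; $S(\Delta_v)$ is the set of all such splines. For a multi-index $\alpha$, $D^\alpha$ is the corresponding partial derivative, of order $|\alpha|$. For an integer $r\ge0$, $S^r(\Delta_v)$ is the set of $\sigma\in S(\Delta_v)$ such that $D^\alpha f_{T_1}|_F=D^\alpha f_{T_2}|_F$ for all $|\alpha|\le r$ and all $T_1,T_2\in\Delta_v$ such that $F=T_1\cap T_2$ is an $(n-1)$-face. For an integer $\rho\ge0$, $C^\rho(\Delta_v)$ is the set of $\sigma\in S(\Delta_v)$ such that $D^\alpha f_{T_1}(v)=D^\alpha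 f_{T_2}(v)$ for all $|\alpha|\le\rho$ and all $T_1,T_2\in\Delta_v$. $\Pi_d$ is the space of real polynomials on $\mathbb{R}^n$ of (total) degree at most $d$. For integers $0\le r\le d$, $S_d^r(\Delta_v)=\{s\in C^r(\Omega_v): s|_T\in\Pi_d \text{ for all } T\in\Delta_v\}$, where $C^r(\Omega_v)$ denotes functions $C^r$ on the closed set $\Omega_v$ (continuous on $\Omega_v$, $C^r$ in its interior, with all partial derivatives up to order $r$ extending continuously to $\Omega_v$). Polynomials are identified with their restrictions to $\Omega_v$, so $\Pi_d\subset S^r_d(\Delta_v)$; the space $S_d^r(\Delta_v)$ is called degenerate if $S_d^r(\Delta_v)=\Pi_d$. *)

(* Defs.v *)
From HB Require Import structures.
From mathcomp Require Import all_boot all_order all_algebra.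
From mathcomp Require Import all_classical all_reals all_analysis.
From mathcomp Require mpoly.

(* The notations of mpoly clash with those of MathComp-Analysis; everything
   else (msize, mdeg, meval, the canonical structures) is imported. *)
Import -(notations) mpoly.

Set Implicit Arguments.
Unset Strict Implicit.
Unset Printing Implicit Defensive.

Import Order.TTheory GRing.Theory Num.Theory.
Import numFieldNormedType.Exports.

Local Open Scope classical_set_scope.
Local Open Scope ring_scope.

Section Meshes.
Variables (R : realType) (n : nat).
Local Notation E := 'rV[R]_n.

Definition affinely_independent (m : nat) (p : 'I_m.+1 -> E) : Prop :=
  row_free (\matrix_(i < m) (p (lift ord0 i) - p ord0)).

Definition hull (m : nat) (p : 'I_m.+1 -> E) : set E :=
  [set x | exists a : 'I_m.+1 -> R,
     [/\ forall i, 0 <= a i, \sum_i a i = 1 & x = \sum_i a i *: p i]].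

Definition is_simplex (m : nat) (T : set E) : Prop :=
  exists2 p : 'I_m.+1 -> E, affinely_independent p & T = hull p.

(* F is a k-face of the m-simplex T: the hull of k+1 of the m+1 vertices of T. *)
Definition is_face (m k : nat) (F T : set E) : Prop :=
  exists p : 'I_m.+1 -> E, [/\ affinely_independent p, T = hull p &
    exists2 q : 'I_k.+1 -> 'I_m.+1, injective q & F = hull (p \o q)].

Definition is_vertex (m : nat) (v : E) (T : set E) : Prop :=
  exists p : 'I_m.+1 -> E, [/\ affinely_independent p, T = hull p &
    exists i, v = p i].

Definition common_face (k : nat) (F T1 T2 : set E) : Prop :=
  is_face n k F T1 /\ is_face n k F T2.

Definition is_mesh (D : set (set E)) : Prop :=
  [/\ finite_set D,
      forall T, D T -> is_simplex n T &
      forall T1 T2, D T1 -> D T2 -> T1 <> T2 ->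
        T1 `&` T2 = set0 \/
        exists2 k, (k < n)%N & common_face k (T1 `&` T2) T1 T2].

Definition mesh_vertex (D : set (set E)) (v : E) : Prop :=
  exists2 T, D T & is_vertex n v T.

Definition cell (D : set (set E)) (v : E) : set (set E) :=
  [set T | D T /\ is_vertex n v T].

Definition cell_union (Dv : set (set E)) : set E := \bigcup_(T in Dv) T.

Definition interior_cell (D : set (set E)) (v : E) : Prop :=
  (cell_union (cell D v))° v.

End Meshes.

Section Derivatives.
Variables (R : realType) (n : nat).
Local Notation E := 'rV[R]_n.

Definition unit_vec (i : 'I_n) : E := delta_mx ord0 i.

Definition partial (i : 'I_n) (f : E -> R) : E -> R :=
  fun x => 'D_(unit_vec i) f x.

Definition partials (s : seq 'I_n) (f : E -> R) : E -> R := foldr partial f s.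

(* D^alpha = (d/dx_0)^alpha_0 ... (d/dx_(n-1))^alpha_(n-1); the order of
   alpha is mdeg alpha. *)
Definition Dmulti (alpha : multinom n) (f : E -> R) : E -> R :=
  partials (flatten [seq nseq (alpha i) i | i <- enum 'I_n]) f.

(* f is C^k on the open set U: all iterated partial derivatives of order at
   most k, in any order of the variables, exist and are continuous on U.  The
   explicit existence clause is needed because 'D_v f x is total. *)
Definition is_Ck (k : nat) (U : set E) (f : E -> R) : Prop :=
  forall s : seq 'I_n, (size s <= k)%N -> forall x, U x ->
    {for x, continuous (partials s f)} /\
    ((size s < k)%N -> forall i, derivable (partials s f) x (unit_vec i)).

Definition is_Coo (U : set E) (f : E -> R) : Prop := forall k, is_Ck k U f.

Definition is_Ck_closed (k : nat) (A : set E) (f : E -> R) : Prop :=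
  [/\ {within A, continuous f}, is_Ck k A° f &
      forall alpha : multinom n, (mdeg alpha <= k)%N ->
        exists2 g : E -> R, {within A, continuous g} &
          forall x, A° x -> g x = Dmulti alpha f x].

End Derivatives.

Section Splines.
Variables (R : realType) (n : nat).
Local Notation E := 'rV[R]_n.

(* The values of piece_fun outside piece_dom are irrelevant. *)
Record piece := Piece { piece_dom : set E; piece_fun : E -> R }.

(* A family indexed by the simplices of the cell is a total function on sets
   whose values off the cell are irrelevant. *)
Definition family := set E -> piece.

Definition splines (Dv : set (set E)) : set family :=
  [set sigma | forall T, Dv T ->
     [/\ open (piece_dom (sigma T)), T `<=` piece_dom (sigma T) &
         is_Coo (piece_dom (sigma T)) (piece_fun (sigma T))]].

Definition splines_Sr (Dv : set (set E)) (r : nat) : set family :=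
  [set sigma | splines Dv sigma /\
     forall T1 T2, Dv T1 -> Dv T2 -> common_face n.-1 (T1 `&` T2) T1 T2 ->
     forall alpha : multinom n, (mdeg alpha <= r)%N ->
     forall x, (T1 `&` T2) x ->
       Dmulti alpha (piece_fun (sigma T1)) x =
       Dmulti alpha (piece_fun (sigma T2)) x].

Definition splines_Crho (Dv : set (set E)) (v : E) (rho : nat) : set family :=
  [set sigma | splines Dv sigma /\
     forall T1 T2, Dv T1 -> Dv T2 ->
     forall alpha : multinom n, (mdeg alpha <= rho)%N ->
       Dmulti alpha (piece_fun (sigma T1)) v =
       Dmulti alpha (piece_fun (sigma T2)) v].

(* msize is the total degree plus one (and msize 0 = 0). *)
Definition polys (d : nat) : set (E -> R) :=
  [set f | exists2 p : mpoly n R, (msize p <= d.+1)%N &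
     forall x : E, f x = meval (x ord0) p].

(* A function on the union A of the cell is represented by its total
   extensions: polys_on and poly_splines contain s or not according to the
   values of s on A alone, and their equality as sets is the equality of the
   corresponding spaces of functions on A. *)
Definition polys_on (A : set E) (d : nat) : set (E -> R) :=
  [set s | exists2 p, polys d p & forall x, A x -> s x = p x].

Definition poly_splines (Dv : set (set E)) (r d : nat) : set (E -> R) :=
  [set s | is_Ck_closed r (cell_union Dv) s /\
     forall T, Dv T -> polys_on T d s].

Definition degenerate (Dv : set (set E)) (r d : nat) : Prop :=
  poly_splines Dv r d = polys_on (cell_union Dv) d.

End Splines.

(* Main.v *)
Require Import Defs.
From mathcomp Require Import all_boot all_order all_algebra.
From mathcomp Require Import all_classical all_reals all_analysis.
From mathcomp Require Import lra ring.
From mathcomp Require mpoly.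
Import -(notations) mpoly.
Set Implicit Arguments.
Unset Strict Implicit.
Unset Printing Implicit Defensive.
Import Order.TTheory GRing.Theory Num.Theory.
Import numFieldNormedType.Exports.
Local Open Scope classical_set_scope.
Local Open Scope ring_scope.

(** Two facts carry the proof: a polynomial of degree at most [rho] is
    determined by its derivatives of order at most [rho] at [v], and replacing
    the pieces of a smooth spline by their Taylor polynomials of degree [rho] at
    [v] preserves the smoothness conditions across facets.

    If S^r is contained in C^rho, consider a polynomial spline of class C^r.  Its
    pieces are polynomials, defined on the whole space, so they form a member of
    S^r; the C^r conditions come from the fact that each simplex is the closure
    of its interior (lemma [continuous_within_unique]).  By hypothesis the pieces
    have the same derivatives up to order [rho] at [v]; a polynomial of degree at
    most [rho] is determined by these (lemma [polys_eq_jet]), so all the pieces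
    are one polynomial ([Sr_sub_Crho_degenerate]).

    Conversely, replace each piece of a member of S^r by its Taylor polynomial
    of degree [rho] at [v].  A facet F shared by two simplices is, near [v], a
    cone with apex [v]: for x in F the segment from [v] to x lies in F, and two
    functions that agree along it have equal iterated derivatives at [v] in the
    direction x - v.  These derivatives determine the Taylor polynomials along
    the whole line, so the derivatives of order at most [r] of the Taylor
    polynomials still agree on F ([taylor_on_facet]).  It remains to see that
    agreement across facets makes the polynomials fit together to a C^r function
    on the union.  Here the cell being interior is essential: near an interior
    point x, a generic segment between two simplices that contain x crosses no
    face of codimension 2, hence passes from simplex to simplex through facets
    that contain x ([facet_connected]).  Points on the boundary of the union
    are reached by scaling towards [v], because two polynomials that agree on
    the beginning of a segment agree on all of it ([agree_everywhere]).  The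
    glued function is a polynomial spline of class C^r ([glue_Ck_closed]), so
    by degeneracy it is one polynomial; then all the Taylor polynomials
    coincide, which is the C^rho condition.

    Two calculus facts are proved by the mean value theorem along lines: mixed
    partial derivatives commute ([derive_comm], [partials_perm]), and the
    derivative in a direction is the linear combination of the partial ones
    ([is_derive_dir]). *)

(** * Directional derivatives *)

Section Directional.
Variables (R : realType) (V : normedModType R).
Implicit Types (f : V -> R) (x a b : V).

Lemma is_derive_line f x a (t : R) :
  derivable f (x + t *: a) a ->
  is_derive t 1 (fun s : R => f (x + s *: a)) ('D_a f (x + t *: a)).
Proof.
move=> df.
have E : (fun h : R => h^-1 *: (((fun s : R => f (x + s *: a)) \o shift t) (h *: 1) -
            f (x + t *: a))) =
         (fun h : R => h^-1 *: ((f \o shift (x + t *: a)) (h *: a) - f (x + t *: a))).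
  apply/funext => h /=; congr (_ *: (f _ - _)).
  by rewrite -[h *: 1]/(h * 1) mulr1 scalerDl addrCA.
by apply: DeriveDef; rewrite /derivable /derive E.
Qed.

Lemma growth_rate_shift f x a b :
  (fun h : R => h^-1 *: (((fun y => f (y + b)) \o shift x) (h *: a) - f (x + b))) =
  (fun h : R => h^-1 *: ((f \o shift (x + b)) (h *: a) - f (x + b))).
Proof. by apply/funext => h /=; rewrite addrA. Qed.

Lemma derive_shift f x a b : 'D_a (fun y => f (y + b)) x = 'D_a f (x + b).
Proof. by rewrite /derive growth_rate_shift. Qed.

Lemma is_derive_shift f x a b :
  derivable f (x + b) a -> is_derive x a (fun y => f (y + b)) ('D_a f (x + b)).
Proof.
move=> df; apply: DeriveDef; last exact: derive_shift.
by rewrite /derivable growth_rate_shift.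
Qed.

Lemma MVT_dir f x a (h : R) :
  (forall t : R, `|t| <= `|h| -> derivable f (x + t *: a) a) ->
  exists2 t : R, `|t| <= `|h| & f (x + h *: a) - f x = h * 'D_a f (x + t *: a).
Proof.
move=> df; pose g (s : R) := f (x + s *: a).
have dg (t : R) : `|t| <= `|h| -> is_derive t 1 g ('D_a f (x + t *: a)).
  by move=> /df /is_derive_line.
have cg (l r : R) : (forall t, t \in `[l, r] -> `|t| <= `|h|) ->
    {within `[l, r], continuous g}.
  by move=> H; apply: derivable_within_continuous => t /H /dg [].
have g0 : g 0 = f x by rewrite /g scale0r addr0.
have [h0|h0] := leP 0 h.
- have H t : t \in `[0, h] -> `|t| <= `|h|.
    by rewrite in_itv /= => /andP[? ?]; rewrite !ger0_norm.
  have [t /H th E] := MVT_segment h0 (fun t th => dg t (H t (subset_itv_oo_cc th))) (cg _ _ H).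
  by exists t => //; rewrite -[f x]g0 -[LHS]/(g h - g 0) E subr0 mulrC.
- have H t : t \in `[h, 0] -> `|t| <= `|h|.
    by rewrite in_itv /= => /andP[? ?]; rewrite !ler0_norm ?lerN2// ltW.
  have [t /H th E] := MVT_segment (ltW h0) (fun t th => dg t (H t (subset_itv_oo_cc th))) (cg _ _ H).
  exists t => //; rewrite -[f x]g0 -[LHS]/(g h - g 0) -[LHS]opprB E sub0r.
  by rewrite mulrN opprK mulrC.
Qed.

Lemma is_derive_dir0 f x : is_derive x 0 f 0.
Proof.
have E : (fun h : R => h^-1 *: ((f \o shift x) (h *: 0) - f x)) = cst 0.
  by apply/funext => h /=; rewrite scaler0 add0r subrr scaler0.
by apply: DeriveDef; rewrite /derivable /derive E; [exact: is_cvg_cst|exact: lim_cst].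
Qed.

(** The increment along [h (c a + b)] splits at [x + h b].  By the mean
    value theorem the part in direction [a] is a derivative at a point that tends
    to [x], where the continuity of ['D_a f] applies. *)
Lemma is_derive_dirD f x a b (c l : R) :
  (\forall y \near x, derivable f y a) -> {for x, continuous ('D_a f)} ->
  is_derive x b f l -> is_derive x (c *: a + b) f (c * 'D_a f x + l).
Proof.
move=> da ca db.
suff H : (fun h : R => h^-1 *: ((f \o shift x) (h *: (c *: a + b)) - f x)) @ 0^'
   --> (c * 'D_a f x + l).
  apply: DeriveDef; first by apply/cvg_ex; eexists; exact: H.
  exact: (cvg_lim _ H).
have -> : (fun h : R => h^-1 *: ((f \o shift x) (h *: (c *: a + b)) - f x)) =
   (fun h : R => h^-1 *: (f (h *: b + x + (h * c) *: a) - f (h *: b + x))) \+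
   (fun h : R => h^-1 *: (f (h *: b + x) - f x)).
  apply/funext => h /=; rewrite -scalerDr addrA subrK; congr (_ *: (f _ - _)).
  by rewrite scalerDr scalerA [RHS]addrC addrA.
apply: cvgD; last first.
  by have [d1 d2] := db; rewrite -d2; exact: d1.
apply/cvgrPdist_le => e e0.
(* 1 is added so that [c1] is positive also when [c = 0] *)
pose c1 := `|c| + 1.
have c10 : 0 < c1 by rewrite ltr_wpDl.
have e1 : 0 < e / c1 by rewrite divr_gt0.
have : \forall y \near x, derivable f y a /\ `|'D_a f x - 'D_a f y| <= e / c1.
  by near=> y; split; [near: y|near: y; apply: cvgr_dist_le].
move=> /nbhs_ballP[d /= d0 Hd].
pose K := `|c| * `|a| + `|b| + 1.
have K0 : 0 < K by rewrite ltr_wpDl// addr_ge0// mulr_ge0.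
have hd : \forall h \near (0 : R)^', h != 0 /\ `|h| < d / K.
  near=> h; split; first by near: h; exact: nbhs_dnbhs_neq.
  by near: h; apply: dnbhs0_lt; exact: divr_gt0.
apply: filterS hd => h [h0 hK].
have inball t : `|t| <= `|h * c| ->
    derivable f (h *: b + x + t *: a) a /\
    `|'D_a f x - 'D_a f (h *: b + x + t *: a)| <= e / c1.
  move=> th; apply: Hd; rewrite -ball_normE /=.
  rewrite [h *: b + x]addrC -addrA opprD addNKr normrN.
  apply: (le_lt_trans (ler_normD _ _)).
  rewrite !normrZ; apply: (@le_lt_trans _ _ (`|h| * K)); last by rewrite -ltr_pdivlMr.
  rewrite normrM in th.
  rewrite /K !mulrDr mulrA mulr1 [X in _ <= X + _]addrC -addrA lerD2l.
  by rewrite (le_trans (ler_wpM2r (normr_ge0 _) th))// lerDl.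
have [t th ->] := MVT_dir (fun t th => (inball t th).1).
rewrite -[_ *: _]/(_ * _) !mulrA mulVf// mul1r -mulrBr normrM.
have := (inball t th).2; rewrite ler_pdivlMr// mulrC => ?.
apply: le_trans (_ : `|c| * _ <= c1 * _) _; first by apply: ler_wpM2r; rewrite // lerDl.
done.
Unshelve. all: end_near. Qed.

(** Applying the mean value theorem in direction [b] to
    [y => f (y + h a) - f y], and then in direction [a] to ['D_b f], writes the
    second difference as a mixed derivative at a nearby point. *)
Lemma second_difference f x a b (d h : R) :
  (forall y, `|y - x| < d -> derivable f y b /\ derivable ('D_b f) y a) ->
  `|h| * (`|a| + `|b|) < d ->
  exists2 z, `|z - x| < d &
   f (x + h *: b + h *: a) - f (x + h *: b) - (f (x + h *: a) - f x) =
     h * (h * 'D_a ('D_b f) z).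
Proof.
move=> df hd.
have near_x s t : `|s| <= `|h| -> `|t| <= `|h| -> `|x + t *: b + s *: a - x| < d.
  move=> sh th; rewrite -[x + _ + _]addrA [x + _]addrC addrK.
  apply: le_lt_trans (ler_normD _ _) (le_lt_trans _ hd).
  rewrite !normrZ mulrDr [leRHS]addrC.
  by apply: lerD; apply: ler_wpM2r.
have dshift t : `|t| <= `|h| -> is_derive (x + t *: b) b
    (fun y => f (y + h *: a) - f y)
    ('D_b f (x + t *: b + h *: a) - 'D_b f (x + t *: b)).
  move=> th; apply: is_deriveB.
    by apply: is_derive_shift; apply: (df _ _).1; exact: near_x.
  apply/derivableP; apply: (df _ _).1.
  by have := near_x 0 t; rewrite scale0r addr0; apply; rewrite ?normr0.
have [t th /=] := MVT_dir (fun t th => @ex_derive _ _ _ _ _ _ _ (dshift t th)).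
rewrite (@derive_val _ _ _ _ _ _ _ (dshift t th)).
have [s sh ->] := MVT_dir (fun s sh => (df _ (near_x s t sh th)).2).
by move=> E; exists (x + t *: b + s *: a); [exact: near_x|rewrite -E; ring].
Qed.

(** The second difference is symmetric in [a] and [b], so
    [second_difference] represents it by values of both mixed derivatives at
    points near [x]; continuity at [x] does the rest. *)
Lemma derive_comm f x a b :
  (\forall y \near x, derivable f y a /\ derivable f y b) ->
  (\forall y \near x, derivable ('D_a f) y b /\ derivable ('D_b f) y a) ->
  {for x, continuous ('D_a ('D_b f))} -> {for x, continuous ('D_b ('D_a f))} ->
  'D_a ('D_b f) x = 'D_b ('D_a f) x.
Proof.
move=> d1 d2 cab cba; apply/eqP; rewrite -subr_eq0 -normr_le0.
apply/ler_addgt0Pr => e e0; rewrite add0r.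
have e2 : 0 < e / 2 by rewrite divr_gt0.
have : \forall y \near x, [/\ derivable f y a /\ derivable f y b,
    derivable ('D_a f) y b /\ derivable ('D_b f) y a,
    `|'D_a ('D_b f) x - 'D_a ('D_b f) y| <= e / 2 &
    `|'D_b ('D_a f) x - 'D_b ('D_a f) y| <= e / 2].
  have nab : \forall y \near x, `|'D_a ('D_b f) x - 'D_a ('D_b f) y| <= e / 2.
    exact: (cvgrPdist_le _ _).1 cab _ e2.
  have nba : \forall y \near x, `|'D_b ('D_a f) x - 'D_b ('D_a f) y| <= e / 2.
    exact: (cvgrPdist_le _ _).1 cba _ e2.
  apply: filterS (filterI (filterI d1 d2) (filterI nab nba)) => y.
  by move=> [[? ?] [? ?]]; split.
move=> /nbhs_ballP[d /= d0 Hd].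
have {}Hd y : `|y - x| < d -> [/\ derivable f y a /\ derivable f y b,
    derivable ('D_a f) y b /\ derivable ('D_b f) y a,
    `|'D_a ('D_b f) x - 'D_a ('D_b f) y| <= e / 2 &
    `|'D_b ('D_a f) x - 'D_b ('D_a f) y| <= e / 2].
  by move=> yd; apply: Hd; rewrite -ball_normE /= distrC.
pose K := `|a| + `|b| + 1.
have K0 : 0 < K by rewrite ltr_wpDl.
pose h := d / 2 / K.
have h0 : 0 < h by rewrite !divr_gt0.
have hd : `|h| * (`|a| + `|b|) < d.
  rewrite gtr0_norm// (@le_lt_trans _ _ (h * K))//.
    by rewrite ler_wpM2l ?lerDl// ltW.
  by rewrite divfK ?gt_eqF//; lra.
have [z1 z1d E1] := @second_difference f x a b d h
  (fun y yd => let: And4 p q _ _ := Hd y yd in conj p.2 q.2) hd.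
have hd' : `|h| * (`|b| + `|a|) < d by rewrite [`|b| + _]addrC.
have [z2 z2d E2] := @second_difference f x b a d h
  (fun y yd => let: And4 p q _ _ := Hd y yd in conj p.1 q.1) hd'.
have E : 'D_a ('D_b f) z1 = 'D_b ('D_a f) z2.
  apply: (mulfI (lt0r_neq0 h0)); apply: (mulfI (lt0r_neq0 h0)).
  have swap (p q r s : R) : p - q - (r - s) = p - r - (q - s) by ring.
  apply: etrans (esym E1) (etrans _ E2); rewrite (addrAC x (h *: b)); exact: swap.
have [_ _ H1 _] := Hd _ z1d; have [_ _ _ H2] := Hd _ z2d; rewrite E in H1.
apply: le_trans (ler_distD ('D_b ('D_a f) z2) _ _) _.
rewrite [leRHS]splitr; apply: lerD; first exact: H1.
by rewrite distrC; exact: H2.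
Qed.

(** A derivative is already determined by the increments with
    positive steps. *)
Lemma derive_eq_right f g x a lf lg (d : R) : 0 < d ->
  is_derive x a f lf -> is_derive x a g lg ->
  (forall t : R, 0 <= t < d -> f (x + t *: a) = g (x + t *: a)) -> lf = lg.
Proof.
move=> d0 [df <-] [dg <-] fg.
have H (k : V -> R) : derivable k x a ->
   (fun h : R => h^-1 *: ((k \o shift x) (h *: a) - k x)) @ (0 : R)^'+ --> 'D_a k x.
  by move=> dk; apply: cvg_trans dk; apply: cvg_app; apply: within_subset => //= t /= /gt_eqF ->.
have fgh : \forall h \near (0 : R)^'+,
    h^-1 *: ((g \o shift x) (h *: a) - g x) = h^-1 *: ((f \o shift x) (h *: a) - f x).
  near=> h; rewrite /=; have h0 : 0 < h by near: h; exact: nbhs_right_gt.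
  have hd : h < d by near: h; exact: nbhs_right_lt.
  rewrite [h *: a + x]addrC fg; last by rewrite (ltW h0).
  by have := fg 0; rewrite lexx d0 scale0r addr0 => ->.
apply: (cvg_unique (@norm_hausdorff _ _) (H f df)).
apply: cvg_trans (H g dg); exact: near_eq_cvg.
Unshelve. all: end_near. Qed.
End Directional.

(** * Iterated partial derivatives of smooth functions *)

Section Partials.
Variables (R : realType) (n : nat).
Local Notation E := 'rV[R]_n.
Implicit Types (f g : E -> R) (U : set E) (x u : E) (s : seq 'I_n).

(** The order bound in the definition of smoothness disappears once
    all orders are taken together; this is the form used below. *)
Lemma is_CooP U f : is_Coo U f <-> forall s x, U x ->
  {for x, continuous (partials s f)} /\
  forall i, derivable (partials s f) x (unit_vec R i).
Proof.
split=> [H s x Ux|H k s _ x Ux]; last by have [? ?] := H s x Ux.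
split; first by have [] := H (size s) s (leqnn _) x Ux.
by have [_] := H (size s).+1 s (leqnSn _) x Ux; apply.
Qed.

Lemma partials_cat s t f : partials (s ++ t) f = partials s (partials t f).
Proof. exact: foldr_cat. Qed.

Lemma is_Coo_partials U f s : is_Coo U f -> is_Coo U (partials s f).
Proof. by move=> /is_CooP H; apply/is_CooP => t; rewrite -partials_cat; exact: H. Qed.

Lemma eq_partials U f g s : open U -> (forall x, U x -> f x = g x) ->
  forall x, U x -> partials s f x = partials s g x.
Proof.
move=> oU fg; elim: s => [|i s IH] //= x Ux.
apply: near_eq_derive.
by near=> y; apply: IH; near: y; apply: open_nbhs_nbhs.
Unshelve. all: end_near. Qed.

Lemma partials_swap U f i j s x : open U -> is_Coo U f -> U x ->
  partials (i :: j :: s) f x = partials (j :: i :: s) f x.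
Proof.
move=> oU /is_CooP Cf Ux /=.
have nU : \forall y \near x, U y by apply: open_nbhs_nbhs.
apply: derive_comm.
- near=> y; have Uy : U y by near: y.
  by have [_ H] := Cf s y Uy; split; exact: H.
- near=> y; have Uy : U y by near: y.
  by split; [have [_] := Cf (i :: s) y Uy|have [_] := Cf (j :: s) y Uy]; apply.
- by have [] := Cf (i :: j :: s) _ Ux.
- by have [] := Cf (j :: i :: s) _ Ux.
Unshelve. all: end_near. Qed.

Lemma partials_cons_eq U f s t i : open U ->
  (forall x, U x -> partials s f x = partials t f x) ->
  forall x, U x -> partials (i :: s) f x = partials (i :: t) f x.
Proof. by move=> oU st x Ux; exact: (@eq_partials U _ _ [:: i]). Qed.

Lemma partials_perm U f s t x : open U -> is_Coo U f -> U x ->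
  perm_eq s t -> partials s f x = partials t f x.
Proof.
move=> oU Cf Ux st.
have front i t1 t2 y : U y ->
    partials (t1 ++ i :: t2) f y = partials (i :: t1 ++ t2) f y.
  elim: t1 y => [|j t1 IH] y Uy //.
  rewrite (@partials_cons_eq U f (t1 ++ i :: t2) (i :: t1 ++ t2) j oU IH y Uy).
  exact: (partials_swap j i (t1 ++ t2) oU Cf Uy).
elim: s t st x Ux => [|i s IH] t st x Ux.
  by have := perm_size st; case: t {st}.
have it : i \in t by rewrite -(perm_mem st) mem_head.
case/splitPr: it st => t1 t2.
rewrite perm_sym (perm_catCA t1 [:: i] t2) perm_cons perm_sym => st.
rewrite front//; apply: (partials_cons_eq _ oU) => // y Uy; exact: IH.
Qed.

Definition multi_index s : multinom n := Multinom [tuple count_mem i s | i < n].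

Lemma perm_multi_index s : perm_eq s (flatten [seq nseq (multi_index s i) i | i <- enum 'I_n]).
Proof.
apply/permP => a.
rewrite count_flatten -map_comp sumnE big_map enumT.
under eq_bigr => i _ do rewrite /= count_nseq mnmE.
elim: s => [|j s IH] /=; first by rewrite big1 // => i _; rewrite muln0.
rewrite IH; under [RHS]eq_bigr => i _ do rewrite mulnDr.
rewrite big_split /=; congr addn.
rewrite (bigD1 j)//= eqxx muln1 big1 ?addn0 // => i ij.
by rewrite eq_sym (negbTE ij) muln0.
Qed.

Lemma size_Dmulti (al : multinom n) :
  size (flatten [seq nseq (al i) i | i <- enum 'I_n]) = mdeg al.
Proof.
rewrite size_flatten /shape -map_comp sumnE big_map big_enum mdegE /=.
by apply: eq_bigr => i _; rewrite size_nseq.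
Qed.

Lemma mdeg_multi_index s : mdeg (multi_index s) = size s.
Proof. by rewrite (perm_size (perm_multi_index s)) size_Dmulti. Qed.

(** Induction runs over lists of differentiations, while the
    smoothness conditions speak of multi-indices; commutation of partial
    derivatives identifies the two. *)
Lemma partialsE U f s x : open U -> is_Coo U f -> U x ->
  partials s f x = Dmulti (multi_index s) f x.
Proof. by move=> oU Cf Ux; exact: (partials_perm oU Cf Ux (perm_multi_index s)). Qed.

(** The coordinates of [u] are added one at a time by
    [is_derive_dirD], which spares the total differential. *)
Lemma is_derive_dir U f x u : open U -> is_Coo U f -> U x ->
  is_derive x u f (\sum_i u ord0 i * partial i f x).
Proof.
move=> oU /is_CooP Cf Ux.
suff H (r : seq 'I_n) : is_derive x (\sum_(i <- r) u ord0 i *: unit_vec R i) f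
    (\sum_(i <- r) u ord0 i * partial i f x).
  by rewrite {1}(row_sum_delta u); exact: H.
elim: r => [|i r IH]; first by rewrite !big_nil; exact: is_derive_dir0.
rewrite !big_cons; apply: is_derive_dirD => //.
- near=> y; have Uy : U y by near: y; apply: open_nbhs_nbhs.
  by have [_] := Cf [::] y Uy.
- by have [] := Cf [:: i] x Ux.
Unshelve. all: end_near. Qed.

(** The [k]-th derivative in direction [u] of [partials s f].  It is
    expanded into iterated partial derivatives so that it is visibly determined by
    the derivatives of order at most [size s + k]. *)
Fixpoint Dline (u : E) (k : nat) s f : E -> R :=
  if k is k'.+1 then fun x => \sum_i u ord0 i * Dline u k' (i :: s) f x
  else partials s f.

Lemma is_derive_Dline U f u k s x : open U -> is_Coo U f -> U x ->
  is_derive x u (Dline u k s f) (Dline u k.+1 s f x).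
Proof.
move=> oU Cf Ux; elim: k s => [|k IH] s.
  exact: (is_derive_dir u oU (is_Coo_partials s Cf) Ux).
have -> : Dline u k.+1 s f = \sum_i (u ord0 i \*: Dline u k (i :: s) f).
  by apply/funext => y; rewrite fct_sumE.
by apply: is_derive_sum => i; apply: is_deriveZ; exact: IH.
Qed.

(** This transfers agreement along a segment to the jets: each
    derivative in the direction of the segment is a one-sided derivative of the
    previous one. *)
Lemma Dline_eq_right U1 U2 f1 f2 x u s k (d : R) :
  open U1 -> open U2 -> is_Coo U1 f1 -> is_Coo U2 f2 -> 0 < d ->
  (forall t, 0 <= t < d -> U1 (x + t *: u) /\ U2 (x + t *: u)) ->
  (forall t, 0 <= t < d -> partials s f1 (x + t *: u) = partials s f2 (x + t *: u)) ->
  forall t, 0 <= t < d -> Dline u k s f1 (x + t *: u) = Dline u k s f2 (x + t *: u).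
Proof.
move=> oU1 oU2 C1 C2 d0 inU E; elim: k => [//|k IH] t td.
have [U1t U2t] := inU t td.
have dt : 0 < d - t by have /andP[_] := td; rewrite subr_gt0.
apply: (derive_eq_right dt (is_derive_Dline u k s oU1 C1 U1t)
  (is_derive_Dline u k s oU2 C2 U2t)) => r /andP[r0 rd].
rewrite -addrA -scalerDl; apply: IH; have /andP[t0 _] := td.
by rewrite addr_ge0//= addrC -ltrBrDr.
Qed.

Lemma eq_Dline f1 f2 x u k s (m : nat) : (size s + k <= m)%N ->
  (forall s', (size s' <= m)%N -> partials s' f1 x = partials s' f2 x) ->
  Dline u k s f1 x = Dline u k s f2 x.
Proof.
move=> + E; elim: k s => [|k IH] s sk /=; first by apply: E; rewrite addn0 in sk.
by apply: eq_bigr => i _; rewrite IH//= addSnnS.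
Qed.

End Partials.

(** * Polynomial functions *)

Section PolynomialFunctions.
Variables (R : realType) (n : nat).
Local Notation E := 'rV[R]_n.
Implicit Types (p q : mpoly n R) (f : E -> R) (x u v : E) (s : seq 'I_n).

Definition mpoly_fun p : E -> R := fun x => meval (x ord0) p.

Lemma polysP (d : nat) f :
  polys d f <-> exists2 p : mpoly n R, (msize p <= d.+1)%N & f = mpoly_fun p.
Proof.
by split=> -[p sp fE]; exists p => //; [apply/funext|move=> x; rewrite fE].
Qed.

Lemma is_derive_coord x i j :
  is_derive x (unit_vec R i) (fun y : E => y ord0 j) (i == j)%:R.
Proof.
have H : (fun h : R => h^-1 *: (((fun y : E => y ord0 j) \o shift x) (h *: unit_vec R i) - x ord0 j))
    @ 0^' --> ((i == j)%:R : R).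
  apply: cvg_near_cst; near=> h; rewrite /= !mxE addrK eqxx /= eq_sym.
  by rewrite -[_ *: _]/(_ * _) mulKf//; near: h; exact: nbhs_dnbhs_neq.
apply: DeriveDef; first by apply/cvg_ex; eexists; exact: H.
exact: (cvg_lim (@norm_hausdorff _ _) H).
Unshelve. all: end_near. Qed.

(** Induction along the algebra structure suits derivatives and
    continuity better than induction on monomials. *)
Lemma mpoly_alg_ind (P : mpoly n R -> Prop) :
  (forall c, P (mpolyC n c)) -> (forall i, P (mpolyX R (mnm1 i))) ->
  (forall p q, P p -> P q -> P (p + q)) -> (forall p q, P p -> P q -> P (p * q)) ->
  forall p, P p.
Proof.
move=> PC PX PD PM p; rewrite [p]mpolyE.
apply: (big_ind P) => //; first by rewrite -mpolyC0.
move=> m _; rewrite -mul_mpolyC; apply: (PM _ _) => //; rewrite mpolyXE_id.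
have P1 : P 1 by rewrite -mpolyC1.
apply: (big_ind P P1 PM) => i _; elim: (m i) => [|k IH]; rewrite ?expr0// exprS.
by apply: PM; [exact: PX|exact: IH].
Qed.

Lemma mpoly_funD p q : mpoly_fun (p + q) = mpoly_fun p + mpoly_fun q.
Proof. by apply/funext => y; exact: mevalD. Qed.

Lemma mpoly_funM p q : mpoly_fun (p * q) = mpoly_fun p * mpoly_fun q.
Proof. by apply/funext => y; exact: mevalM. Qed.

Lemma is_derive_mpoly_fun p x i :
  is_derive x (unit_vec R i) (mpoly_fun p) (mpoly_fun (mderiv i p) x).
Proof.
elim/mpoly_alg_ind: p => [c|j|p q IHp IHq|p q IHp IHq].
- rewrite mderivC /mpoly_fun meval0.
  have -> : (fun y : E => meval (y ord0) (mpolyC n c)) = cst c.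
    by apply/funext => y; rewrite mevalC.
  exact: is_derive_cst.
- rewrite mderivX mnm1E /mpoly_fun.
  have -> : (fun y : E => meval (y ord0) (mpolyX R (mnm1 j))) = fun y => y ord0 j.
    by apply/funext => y; rewrite mevalXU.
  have -> : meval (x ord0) ((j == i)%:R *: mpolyX R (mnm_sub (mnm1 j) (mnm1 i))) = (i == j)%:R.
    rewrite mevalZ eq_sym; case: eqP => [->|_]; last by rewrite mul0r.
    rewrite mul1r (_ : mnm_sub _ _ = @mnm0 n) ?mpolyX0 ?meval1//.
    by apply/mnmP => k; rewrite mnmBE subnn mnm0E.
  exact: is_derive_coord.
- by rewrite mderivD !mpoly_funD; exact: is_deriveD.
- rewrite mpoly_funM; apply: is_derive_eq (is_deriveM _ _) _.
  rewrite mderivM mpoly_funD !mpoly_funM addrC.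
  by congr (_ + _); exact: mulrC.
Qed.

Lemma continuous_mpoly_fun p : continuous (mpoly_fun p).
Proof.
elim/mpoly_alg_ind: p => [c|j|p q IHp IHq|p q IHp IHq] x.
- have -> : mpoly_fun (mpolyC n c) = cst c.
    by apply/funext => y; rewrite /mpoly_fun mevalC.
  exact: cst_continuous.
- have -> : mpoly_fun (mpolyX R (mnm1 j)) = fun y => y ord0 j.
    by apply/funext => y; rewrite /mpoly_fun mevalXU.
  exact: coord_continuous.
- by rewrite mpoly_funD; exact: (continuousD (IHp x) (IHq x)).
- by rewrite mpoly_funM; exact: (continuousM (IHp x) (IHq x)).
Qed.

Lemma partials_mpoly_fun s p : partials s (mpoly_fun p) = mpoly_fun (foldr (@mderiv n R) p s).
Proof.
elim: s => [//|i s IH] /=; rewrite IH; apply/funext => x.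
by have [_] := is_derive_mpoly_fun (foldr (@mderiv n R) p s) x i.
Qed.

Lemma is_Coo_polys U d f : polys d f -> is_Coo U f.
Proof.
move=> /polysP[p _ ->]; apply/is_CooP => s x _; rewrite partials_mpoly_fun.
split; first exact: continuous_mpoly_fun.
by move=> i; have [] := is_derive_mpoly_fun (foldr (@mderiv n R) p s) x i.
Qed.

Lemma partials_polys0 d f s : polys d f -> (d < size s)%N -> partials s f = cst 0.
Proof.
move=> /polysP[p sp ->] ds; rewrite partials_mpoly_fun.
rewrite (mderiv_perm _ (perm_multi_index s)) -mderivm_foldr.
suff -> : mderivm (multi_index s) p = 0 by apply/funext => x; rewrite /mpoly_fun meval0.
apply/mpolyP => m; rewrite mcoeff_mderivm mcoeff0 memN_msupp_eq0 ?mul0rn//.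
apply: msize_mdeg_ge; apply: leq_trans sp (leq_trans ds _).
by rewrite -(mdeg_multi_index s) mdegD leq_addr.
Qed.

Lemma Dline_polys0 d f u k s : polys d f -> (d < size s + k)%N -> Dline u k s f = cst 0.
Proof.
move=> pf; elim: k s => [|k IH] s ds.
  by apply: (partials_polys0 pf); rewrite addn0 in ds.
apply/funext => x /=; apply: big1 => i _.
by rewrite IH ?mulr0//= addSnnS.
Qed.

(** Above the degree all derivatives vanish, so there the two
    families agree on the whole line.  This descends to the lower orders, because
    a function with zero derivative along a line is constant on it, and the
    constant is read off at [x]. *)
Lemma polys_eq_on_line d f1 f2 x u s : polys d f1 -> polys d f2 ->
  (forall k, Dline u k s f1 x = Dline u k s f2 x) ->
  forall t, partials s f1 (x + t *: u) = partials s f2 (x + t *: u).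
Proof.
move=> pf1 pf2 E t0; rewrite -/(Dline u 0 s f1 _) -/(Dline u 0 s f2 _).
(* descending induction on the order [k], with [j] counting the steps down from [d] *)
suff H j : forall k, (d < k + j)%N -> forall t,
    Dline u k s f1 (x + t *: u) = Dline u k s f2 (x + t *: u).
  exact: (H d.+1 0%N).
elim: j => [|j IH] k dk t.
  rewrite addn0 in dk.
  have dk' : (d < size s + k)%N by apply: leq_trans dk (leq_addl _ _).
  by rewrite !(Dline_polys0 _ _ dk').
pose g := Dline u k s f1 - Dline u k s f2.
have dg y : is_derive y u g (Dline u k.+1 s f1 y - Dline u k.+1 s f2 y).
  by apply: is_deriveB; apply: (@is_derive_Dline R n setT) => //; try exact: openT; apply: is_Coo_polys; eassumption.
have [c _] := @MVT_dir R _ g x u t (fun c _ => @ex_derive _ _ _ _ _ _ _ (dg (x + c *: u))).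
rewrite (@derive_val _ _ _ _ _ _ _ (dg (x + c *: u))) IH ?addSnnS// subrr mulr0.
have -> : g x = 0 by apply/eqP; rewrite subr_eq0; apply/eqP; exact: E.
by rewrite subr0 => /eqP; rewrite subr_eq0 => /eqP.
Qed.

(** A polynomial of degree at most [d] is given by its Taylor
    expansion of order [d] at any point. *)
Lemma polys_eq_jet d f1 f2 x : polys d f1 -> polys d f2 ->
  (forall s, (size s <= d)%N -> partials s f1 x = partials s f2 x) -> f1 = f2.
Proof.
move=> pf1 pf2 E; apply/funext => y.
have := @polys_eq_on_line d f1 f2 x (y - x) [::] pf1 pf2 _ 1.
rewrite scale1r [x + _]addrC subrK; apply => k.
have [kd|dk] := leqP k d; first exact: (eq_Dline _ (m := d)).
by rewrite !(@Dline_polys0 d _ _ _ [::]).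
Qed.

(** Agreement near the beginning of a segment fixes the jet there
    in the direction of the segment, hence the values up to its end. *)
Lemma polys_eq_germ d f1 f2 x u s (e : R) : polys d f1 -> polys d f2 -> 0 < e ->
  (forall t, 0 <= t < e -> partials s f1 (x + t *: u) = partials s f2 (x + t *: u)) ->
  partials s f1 (x + u) = partials s f2 (x + u).
Proof.
move=> pf1 pf2 e0 E.
have := @polys_eq_on_line d f1 f2 x u s pf1 pf2 _ 1; rewrite scale1r; apply => k.
have := @Dline_eq_right R n setT setT f1 f2 x u s k e openT openT
  (is_Coo_polys pf1) (is_Coo_polys pf2) e0 (fun _ _ => conj I I) E 0.
by rewrite scale0r addr0; apply; rewrite lexx.
Qed.

Lemma partials_translate s f v x :
  partials s (fun y => f (y + v)) x = partials s f (x + v).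
Proof.
elim: s x => [//|i s IH] x /=.
rewrite /partial (_ : partials s _ = fun y => partials s f (y + v)).
  exact: derive_shift.
by apply/funext => y; rewrite IH.
Qed.

Lemma meval_zero p : meval ((0 : E) ord0) p = mcoeff (@mnm0 n) p.
Proof.
rewrite mevalE [in RHS](mpolyE p) raddf_sum /=.
apply: eq_bigr => m _; rewrite mcoeffZ mcoeffX; congr (_ * _).
have [->|m0] := eqVneq m (@mnm0 n).
  by rewrite big1 // => i _; rewrite mnm0E expr0.
have [i mi] : exists i, m i != 0%N.
  apply: contrapT => H; move/eqP: m0; apply; apply/mnmP => i; rewrite mnm0E.
  by apply/eqP; apply: contrapT => mi; apply: H; exists i; apply/negP.
by rewrite (bigD1 i)//= mxE expr0n (negbTE mi) mul0r.
Qed.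

(** Degrees add; [msize] is the degree plus one. *)
Lemma msizeM_leS p q (k l : nat) :
  (msize p <= k.+1)%N -> (msize q <= l.+1)%N -> (msize (p * q) <= (k + l).+1)%N.
Proof.
move=> pk ql.
have [->|p0] := eqVneq p 0; first by rewrite mul0r mmeasure0.
have [->|q0] := eqVneq q 0; first by rewrite mulr0 mmeasure0.
by rewrite msizeM// -subn1 leq_subLR add1n -addSn -addnS leq_add.
Qed.

(** The Taylor polynomial with prescribed derivatives [c] at [v]: it
    is the sum of [c m / m!] times the monomial [m] in the variables shifted by
    [v], so that its derivatives at [v] are the derivatives at 0 of the unshifted
    sum [q]. *)
Lemma taylor_polys d (c : multinom n -> R) v :
  exists2 f : E -> R, polys d f & forall m, (mdeg m <= d)%N -> Dmulti m f v = c m.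
Proof.
pose a (m : multinom n) : R := c m / (\prod_(i < n) (m i)`!)%:R.
pose q : mpoly n R := \sum_(k : bmultinom n d.+1) a k *: mpolyX R k.
pose p : mpoly n R := \sum_(k : bmultinom n d.+1)
  a k *: \prod_(i < n) (mpolyX R (mnm1 i) - mpolyC n (v ord0 i)) ^+ k i.
have pE : mpoly_fun p = fun x => mpoly_fun q (x - v).
  apply/funext => x; rewrite /mpoly_fun !raddf_sum /=; apply: eq_bigr => k _.
  rewrite !mevalZ mevalX rmorph_prod /=; congr (_ * _); apply: eq_bigr => i _.
  by rewrite rmorphXn /= mevalB mevalXU mevalC !mxE.
exists (mpoly_fun p).
  apply/polysP; exists p => //.
  apply: leq_trans (mmeasure_sum _ _ _ _) _; apply/bigmax_leqP => k _.
  apply: leq_trans (msizeZ_le _ _) _; apply: leq_trans (bmdeg k).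
  rewrite mdegE.
  apply: (big_ind2 (fun (p : mpoly n R) m => (msize p <= m.+1)%N)) => [||i _].
  - by rewrite msize1.
  - by move=> p1 m1 p2 m2; exact: msizeM_leS.
  - elim: (k i) => [|j IH]; first by rewrite expr0 msize1.
    rewrite exprS; apply: (@msizeM_leS _ _ 1) IH.
    apply: leq_trans (mmeasureD_le _ _ _) _.
    by rewrite geq_max msizeX mdeg1 mmeasureN mmeasureC //; case: eqP.
move=> m md; rewrite /Dmulti pE partials_translate subrr partials_mpoly_fun -mderivm_foldr.
rewrite /mpoly_fun meval_zero mcoeff_mderivm addm0.
have -> : mcoeff m q = a m.
  rewrite raddf_sum /= (bigD1 (@BMultinom n d.+1 m md)) //= mcoeffZ mcoeffX eqxx mulr1.
  rewrite big1 ?addr0 // => k km; rewrite mcoeffZ mcoeffX.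
  by case: eqP => [E|_]; rewrite ?mulr0//; case/eqP: km; apply: val_inj.
under eq_bigr do rewrite ffactnn.
rewrite -mulr_natr divfK// pnatr_eq0 -lt0n prodn_gt0// => i; exact: fact_gt0.
Qed.

End PolynomialFunctions.

(** * Avoiding finitely many hyperplanes *)

Lemma continuous_sum_fun (R : realType) (T : topologicalType) (I : Type) (r : seq I)
    (F : I -> T -> R) :
  (forall i, continuous (F i)) -> continuous (fun x => \sum_(i <- r) F i x).
Proof.
move=> cF x; elim: r => [|i r IH].
  have -> : (fun x => \sum_(i <- [::]) F i x) = cst 0.
    by apply/funext => y; rewrite big_nil.
  exact: cst_continuous.
have -> : (fun x => \sum_(i <- i :: r) F i x) = fun x => F i x + \sum_(i <- r) F i x.
  by apply/funext => y; rewrite big_cons.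
exact: continuousD (cF i x) IH.
Qed.

Lemma near_finite (S : Type) (F : set_system S) (I : eqType) (D : set I)
    (P : I -> S -> Prop) : Filter F -> finite_set D ->
  (forall i, D i -> \forall y \near F, P i y) ->
  \forall y \near F, forall i, D i -> P i y.
Proof.
move=> FF /finite_seqP[r ->]; elim: r => [|i r IH] H.
  by apply: filterE => y j; rewrite /= in_nil.
have Hr : \forall y \near F, forall j, j \in r -> P j y.
  by apply: IH => j jr; apply: H; rewrite /= inE jr orbT.
have Hi := H i (mem_head _ _).
apply: filterS (filterI Hi Hr) => y [Piy Pry] j /=.
by rewrite inE => /orP[/eqP ->//|]; exact: Pry.
Qed.

Section Forms.
Variables (R : realType) (n : nat).
Local Notation E := 'rV[R]_n.
Implicit Types (x y : E) (u : 'cV[R]_n) (V W : set E) (t : R).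

Lemma continuous_line x y : continuous (fun t : R => x + t *: y).
Proof.
move=> t; have H : {for t, continuous (fun t : R => x + t *: y)}.
  by apply: continuousD; [exact: cst_continuous|apply: continuousZl; exact: cvg_id].
exact: H.
Qed.

Definition linform u x : R := (x *m u) ord0 ord0.

Lemma linform_segment u x y t : linform u (x + t *: (y - x)) = linform u x + t * (linform u y - linform u x).
Proof. by rewrite /linform mulmxDl -scalemxAl mulmxBl !mxE. Qed.

Lemma linform_sum u m (a : 'I_m -> R) (q : 'I_m -> E) :
  linform u (\sum_i a i *: q i) = \sum_i a i * linform u (q i).
Proof.
rewrite /linform mulmx_suml summxE; apply: eq_bigr => i _.
by rewrite -scalemxAl mxE.
Qed.

Lemma continuous_linform u : continuous (linform u).
Proof.
rewrite /linform.
have -> : (fun y : E => (y *m u) ord0 ord0) = fun y => \sum_k y ord0 k * u k ord0.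
  by apply/funext => y; rewrite mxE.
apply: continuous_sum_fun => k y; apply: continuousM; last exact: cst_continuous.
exact: coord_continuous.
Qed.

(** At most [n] points lie in a common hyperplane, because
    fewer than [n] difference vectors have a nonzero vector in their cokernel. *)
Lemma points_in_hyperplane m (q : 'I_m.+1 -> E) : (m < n)%N ->
  exists2 u, u != 0 & forall i, linform u (q i) = linform u (q ord0).
Proof.
move=> mn; pose M := \matrix_(i < m) (q (lift ord0 i) - q ord0).
have : cokermx M != 0.
  by rewrite -mxrank_eq0 mxrank_coker subn_eq0 -ltnNge (leq_ltn_trans (rank_leq_row _)).
move=> C0; have [j uj] : exists j, col j (cokermx M) != 0.
  apply: contrapT => H; case/eqP: C0; apply/matrixP => i j; rewrite mxE.
  have /eqP/matrixP/(_ i ord0) : col j (cokermx M) == 0.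
    by apply: contrapT => /negP ?; apply: H; exists j.
  by rewrite !mxE.
exists (col j (cokermx M)) => // i; case: (unliftP ord0 i) => [k ->|->//].
apply/eqP; rewrite -subr_eq0 /linform.
have -> : forall a b : 'M[R]_1, a ord0 ord0 - b ord0 ord0 = (a - b) ord0 ord0.
  by move=> a b; rewrite !mxE.
rewrite -mulmxBl -(rowK (fun k => q (lift ord0 k) - q ord0)) -/M.
have -> : row k M *m col j (cokermx M) = \matrix_(a, b) (M *m cokermx M) k j.
  by apply/matrixP => a b; rewrite !mxE; apply: eq_bigr => l _; rewrite !mxE.
by rewrite mulmx_coker !mxE.
Qed.

(** The guard makes the empty set qualify also when [n = 0], where no
    hyperplane exists. *)
Definition in_hyperplane W := W !=set0 -> exists u c, u != 0 /\ forall x, W x -> linform u x = c.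

(** A nonempty open set is not contained in a hyperplane:
    move along a coordinate vector on which the linear form does not vanish. *)
Lemma open_minus_hyperplane V W : open V -> V !=set0 -> in_hyperplane W ->
  exists V', [/\ open V', V' !=set0, V' `<=` V & forall x, V' x -> ~ W x].
Proof.
move=> oV [x Vx] tW.
have [/tW [u [c [u0 Wc]]]|W0] := pselect (W !=set0); last first.
  by exists V; split=> // [|y _ Wy]; [exists x|apply: W0; exists y].
exists (V `&` linform u @^-1` [set s | s != c]); split.
- apply: openI => //; apply: open_comp; last exact: open_neq.
  by move=> y _; exact: continuous_linform.
- have [xc|xc] := eqVneq (linform u x) c; last by exists x; split.
  have [k uk] : exists k, u k ord0 != 0.
    apply: contrapT => H; move/eqP: u0; apply; apply/matrixP => k j.
    rewrite !mxE ord1; apply/eqP; apply: contrapT => /negP ukj.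
    by apply: H; exists k.
  have ct := @continuous_line x (delta_mx 0 k) (0 : R).
  have nV : nbhs (x + (0 : R) *: delta_mx 0 k) V.
    by rewrite scale0r addr0; apply: open_nbhs_nbhs.
  have {}nV : \forall t \near (0 : R)^'+, V (x + t *: delta_mx 0 k).
    by apply: cvg_within; exact: ct nV.
  have /filter_ex [t [Vt t0]] : \forall t \near (0 : R)^'+, V (x + t *: delta_mx 0 k) /\ 0 < t.
    by apply: filterI => //; exact: nbhs_right_gt.
  exists (x + t *: delta_mx 0 k); split => //=.
  rewrite /linform mulmxDl -scalemxAl -rowE [X in X != _]mxE -/(linform u x) xc.
  rewrite [X in _ + X]mxE [X in _ * X]mxE -subr_eq0 [c + _]addrC addrK.
  exact: mulf_neq0 (lt0r_neq0 t0) uk.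
- by move=> y [].
- by move=> y [_ /eqP yc] /Wc.
Qed.

Lemma open_avoid_hyperplanes (I : eqType) (r : seq I) (W : I -> set E) V :
  open V -> V !=set0 -> (forall i, i \in r -> in_hyperplane (W i)) ->
  exists2 y, V y & forall i, i \in r -> ~ W i y.
Proof.
elim: r V => [|i r IH] V oV V0 tW; first by have [y Vy] := V0; exists y.
have [V' [oV' V'0 V'V HV']] := open_minus_hyperplane oV V0 (tW i (mem_head _ _)).
have [j jr|y V'y Hy] := IH V' oV' V'0; first by apply: tW; rewrite inE jr orbT.
exists y; first exact: V'V.
by move=> j; rewrite inE => /orP[/eqP ->|/Hy//]; exact: HV'.
Qed.

End Forms.

(** * Simplices and connection through facets *)

Section Simplices.
Variables (R : realType) (n : nat).
Local Notation E := 'rV[R]_n.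
Implicit Types (x y : E) (T : set E).

(** The coordinates are those of [x - p 0] in the basis of edge
    vectors [p i - p 0], the coordinate at [p 0] being 1 minus their sum. *)
Lemma barycentric (p : 'I_n.+1 -> E) : affinely_independent p ->
  exists L : 'I_n.+1 -> E -> R,
   [/\ forall i, continuous (L i), forall x, \sum_i L i x = 1,
      forall x, \sum_i L i x *: p i = x &
      forall a, \sum_i a i = 1 -> forall i, L i (\sum_j a j *: p j) = a i].
Proof.
rewrite /affinely_independent; set M := \matrix_(i < n) _.
rewrite row_free_unit => Mu; pose c x : 'rV[R]_n := (x - p ord0) *m invmx M.
have cM x : \sum_j c x ord0 j *: (p (lift ord0 j) - p ord0) = x - p ord0.
  rewrite -[RHS]mulmx1 -(mulVmx Mu) mulmxA -/(c x) mulmx_sum_row.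
  by apply: eq_bigr => j _; rewrite rowK.
have cc j : continuous (fun x => c x ord0 j).
  have -> : (fun x => c x ord0 j) = (fun x => linform (col j (invmx M)) x + - (linform (col j (invmx M)) (p ord0))).
    by apply/funext => x; rewrite /c /linform mulmxBl !mxE; congr (_ - _); apply: eq_bigr => k _; rewrite mxE.
  by move=> x; apply: continuousD; [exact: continuous_linform|exact: cst_continuous].
exists (fun i x => if unlift ord0 i is Some j then c x ord0 j else 1 - \sum_j c x ord0 j).
split.
- move=> i; case: (unlift ord0 i) => [j|]; first exact: cc.
  move=> x; apply: continuousB; first exact: cst_continuous.
  exact: continuous_sum_fun.
- move=> x; rewrite big_ord_recl unlift_none.
  by under [X in _ + X]eq_bigr do rewrite liftK; rewrite subrK.
- move=> x; rewrite big_ord_recl unlift_none.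
  under [X in _ + X]eq_bigr do rewrite liftK.
  apply: (addIr (- p ord0)); rewrite -[RHS]cM.
  under [RHS]eq_bigr do rewrite scalerBr.
  by rewrite sumrB -scaler_suml scalerBl scale1r addrAC [p ord0 - _]addrC addrK addrC.
- move=> a a1 i; set x := \sum_j _.
  have ca : c x = \row_j a (lift ord0 j).
    rewrite /c; have -> : x - p ord0 = (\row_j a (lift ord0 j)) *m M.
      rewrite /x mulmx_sum_row -{1}[p ord0]scale1r -a1 !big_ord_recl scalerDl.
      rewrite opprD addrACA subrr add0r scaler_suml -sumrB.
      by apply: eq_bigr => j _; rewrite mxE rowK scalerBr.
    by rewrite mulmxK.
  case: unliftP => [j ->|->]; first by rewrite ca mxE.
  rewrite ca; under eq_bigr do rewrite mxE.
  by rewrite -a1 big_ord_recl addrK.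
Qed.

Lemma hull_barycentric (p : 'I_n.+1 -> E) (L : 'I_n.+1 -> E -> R) x :
  (forall x, \sum_i L i x = 1) -> (forall x, \sum_i L i x *: p i = x) ->
  (forall a, \sum_i a i = 1 -> forall i, L i (\sum_j a j *: p j) = a i) ->
  hull p x <-> forall i, 0 <= L i x.
Proof.
move=> L1 Lx La; split=> [[a [a0 a1 ->]] i|L0]; first by rewrite La.
by exists (fun i => L i x); split.
Qed.

Lemma vertex_in_hull m (p : 'I_m.+1 -> E) i : hull p (p i).
Proof.
exists (fun j => (j == i)%:R); split.
- by move=> j; rewrite ler0n.
- by rewrite (bigD1 i)//= eqxx big1 ?addr0// => j /negbTE ->.
- rewrite (bigD1 i)//= eqxx scale1r big1 ?addr0// => j /negbTE ->.
  by rewrite scale0r.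
Qed.

Lemma simplex_closed T : is_simplex n T -> closed T.
Proof.
move=> [p /barycentric [L [Lc L1 Lx La]] ->].
have -> : hull p = \bigcap_(i in [set: 'I_n.+1]) L i @^-1` [set s | 0 <= s].
  apply/seteqP; split=> [x /(hull_barycentric x L1 Lx La) H i _|x H]; first exact: H.
  by apply/(hull_barycentric x L1 Lx La) => i; exact: H.
by apply: closed_bigI => i _; apply: preimage_closed; [move=> x _; exact: Lc|exact: closed_ge].
Qed.

(** A point of a simplex is approached along the segment to the
    barycenter, on which all barycentric coordinates are positive. *)
Lemma simplex_dense_interior T : is_simplex n T -> T `<=` closure T°.
Proof.
move=> [p /barycentric [L [Lc L1 Lx La]] ->] x Tx B Bx.
have pos_int y : (forall i, 0 < L i y) -> (hull p)° y.
  move=> Ly; have Hi i : \forall z \near y, 0 < L i z.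
    exact: (cvgr_gt _ (Lc i y) _ (Ly i)).
  have H : \forall z \near y, forall i, 0 < L i z.
    exact: (@filter_forall _ _ (fun i z => 0 < L i z) _ (nbhs_filter y) Hi).
  apply: filterS H => z Lz; apply/(hull_barycentric z L1 Lx La) => i; exact: ltW.
pose w : R := n.+1%:R^-1.
have w0 : 0 < w by rewrite invr_gt0.
pose b : E := \sum_i w *: p i.
have w1 : \sum_(i < n.+1) w = 1.
  by rewrite sumr_const card_ord -mulr_natl mulfV ?pnatr_eq0.
have cb := @continuous_line R n x (b - x) (0 : R).
have nB : \forall t \near (0 : R)^'+, B (x + t *: (b - x)).
  by apply: cvg_within; apply: cb; rewrite scale0r addr0.
have /filter_ex [t [Bt [t0 t1]]] :
    \forall t \near (0 : R)^'+, B (x + t *: (b - x)) /\ 0 < t /\ t < 1.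
  apply: filterI => //; apply: filterI; first exact: nbhs_right_gt.
  exact: nbhs_right_lt.
exists (x + t *: (b - x)); split => //; apply: pos_int => i.
have -> : x + t *: (b - x) = \sum_j ((1 - t) * L j x + t * w) *: p j.
  rewrite -[in LHS](Lx x) -sumrB scaler_sumr -big_split /=.
  by apply: eq_bigr => j _; rewrite -scalerBl scalerA -scalerDl; congr (_ *: _); ring.
rewrite La; last by rewrite big_split /= -!mulr_sumr L1 w1; ring.
rewrite ltr_wpDl ?mulr_gt0// mulr_ge0 ?subr_ge0 ?(ltW t1)//.
exact: (hull_barycentric x L1 Lx La).1.
Qed.

Lemma segment_hull m (p : 'I_m.+1 -> E) x y (t : R) : 0 <= t <= 1 ->
  hull p x -> hull p y -> hull p (x + t *: (y - x)).
Proof.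
move=> /andP[t0 t1] [a [a0 a1 ->]] [b [b0 b1 ->]].
exists (fun i => a i + t * (b i - a i)); split.
- move=> i; rewrite (_ : _ + _ = (1 - t) * a i + t * b i); last by ring.
  by rewrite addr_ge0// mulr_ge0// subr_ge0.
- by rewrite big_split /= -mulr_sumr sumrB a1 b1 subrr mulr0 addr0.
- rewrite -sumrB scaler_sumr -big_split /=; apply: eq_bigr => i _.
  by rewrite -scalerBl scalerA -scalerDl.
Qed.

Lemma segment_ball x y z (e t : R) : 0 <= t <= 1 ->
  ball x e y -> ball x e z -> ball x e (y + t *: (z - y)).
Proof.
rewrite -ball_normE /= => /andP[t0 t1] xy xz.
have -> : x - (y + t *: (z - y)) = (1 - t) *: (x - y) + t *: (x - z).
  by apply/rowP => i; rewrite !mxE; ring.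
pose M := Num.max `|x - y| `|x - z|.
have Me : M < e by rewrite gt_max xy xz.
apply: le_lt_trans (ler_normD _ _) (le_lt_trans _ Me).
have -> : M = (1 - t) * M + t * M by ring.
rewrite !normrZ (ger0_norm t0) ger0_norm ?subr_ge0//.
by rewrite lerD// ler_wpM2l ?subr_ge0// le_max lexx ?orbT.
Qed.

(** A closed set that does not contain [x] is far from [x], and
    finitely many can be avoided at once. *)
Lemma near_mem_closed (D : set (set E)) x : finite_set D -> (forall T, D T -> closed T) ->
  \forall y \near x, forall T, D T -> T y -> T x.
Proof.
move=> fD cD; apply: (@near_finite E (nbhs x) _ D (fun T y => T y -> T x) (nbhs_filter x) fD).
move=> T DT.
have [Tx|nTx] := pselect (T x); first by apply: filterE.
have : nbhs x (~` T) by apply: open_nbhs_nbhs; split => //; exact: closed_openC (cD T DT).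
by apply: filterS => y nTy Ty; have := nTy Ty.
Qed.

Lemma near_cover (D : set (set E)) x : finite_set D -> (forall T, D T -> closed T) ->
  (cell_union D)° x -> \forall y \near x, exists T, [/\ D T, T x & T y].
Proof.
move=> fD cD Dx; apply: filterS (filterI Dx (near_mem_closed x fD cD)).
by move=> y [[T DT Ty] Hy]; exists T; split => //; exact: Hy T DT Ty.
Qed.

(** Fewer than [n] points span an affine subspace of codimension at
    least 2. *)
Definition in_codim2_hull (W : set E) : Prop :=
  exists m (q : 'I_m.+1 -> E), (m.+1 < n)%N /\ W `<=` hull q.

Lemma linform_hull m (q : 'I_m.+1 -> E) u c x :
  (forall i, linform u (q i) = c) -> hull q x -> linform u x = c.
Proof.
move=> uq [a [_ a1 ->]]; rewrite linform_sum.
by under eq_bigr do rewrite uq; rewrite -mulr_suml a1 mul1r.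
Qed.

Lemma codim2_in_hyperplane W : in_codim2_hull W -> in_hyperplane W.
Proof.
move=> [m [q [mn Wq]]] _; have [u u0 uq] := points_in_hyperplane q (ltnW mn).
by exists u, (linform u (q ord0)); split=> // x /Wq; exact: linform_hull.
Qed.

(** The points from which [y] sees a set of codimension 2
    form a set of codimension 1: a hyperplane through [y] and the fewer than [n]
    spanning points contains all of them. *)
Lemma codim2_cone_in_hyperplane W y : in_codim2_hull W -> ~ W y ->
  in_hyperplane [set z | exists2 t, 0 <= t <= 1 & W (y + t *: (z - y))].
Proof.
move=> [m [q [mn Wq]]] nWy _.
pose q' (i : 'I_m.+2) := if unlift ord0 i is Some j then q j else y.
have [u u0 uq] := points_in_hyperplane q' mn.
have uy : linform u (q' ord0) = linform u y by rewrite /q' unlift_none.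
exists u, (linform u y); split=> // z [t _ Wt].
have t0 : t != 0.
  by apply/eqP => t0; apply: nWy; rewrite -[y]addr0 -(scale0r (z - y)) -t0.
have qy i : linform u (q i) = linform u y.
  by have := uq (lift ord0 i); rewrite uy /q' liftK.
have /eqP := linform_hull qy (Wq _ Wt).
rewrite linform_segment -subr_eq0 addrC addKr mulf_eq0 (negbTE t0) /= subr_eq0.
by move=> /eqP.
Qed.

(** Suppose that the simplices at [x] are separated into two classes
    by the value of [c].  A segment between points of the two classes near [x] is
    covered by the two closed unions, hence meets their intersection, which by
    hypothesis lies in finitely many sets of codimension 2.  For generic end
    points the segment misses these sets. *)
Lemma facet_connected (D : set (set E)) (c : set E -> R) x :
  finite_set D -> (forall T, D T -> closed T /\ T `<=` closure T°) ->
  (cell_union D)° x ->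
  (forall T1 T2, D T1 -> D T2 -> T1 x -> T2 x -> c T1 <> c T2 ->
     in_codim2_hull (T1 `&` T2)) ->
  forall T1 T2, D T1 -> D T2 -> T1 x -> T2 x -> c T1 = c T2.
Proof.
move=> fD DT Dx facet T1 T2 D1 D2 T1x T2x; apply: contrapT => c12.
have /nbhs_ballP[e /= e0 cover] := near_cover fD (fun T dT => (DT T dT).1) Dx.
have [r rD] : exists r : seq (set E), D = [set` r] by exact/finite_seqP.
have inr T : D T -> T \in r by rewrite rD.
pose bad (p : set E * set E) := [/\ D p.1, D p.2, p.1 x, p.2 x & c p.1 <> c p.2].
pose W p := [set y | bad p /\ (p.1 `&` p.2) y].
pose rr := [seq (T, T') | T <- r, T' <- r].
have Wcodim p : W p !=set0 -> in_codim2_hull (W p).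
  move=> [y [[Dp1 Dp2 p1x p2x cp] _]].
  have [m [q [mn Wq]]] := facet _ _ Dp1 Dp2 p1x p2x cp.
  by exists m, q; split=> // z [_ /Wq].
have generic T (Z : set E * set E -> set E) : D T -> T x ->
    (forall p, in_hyperplane (Z p)) ->
    exists y, [/\ T y, ball x e y & forall p, p \in rr -> ~ Z p y].
  move=> dT Tx tZ; have oV : open (T° `&` ball x e).
    by apply: openI; [exact: open_interior|exact: ball_open].
  have V0 : T° `&` ball x e !=set0.
    exact: (DT T dT).2 x Tx _ (nbhsx_ballx x e e0).
  have [y [/interior_subset Ty By] Hy] := open_avoid_hyperplanes oV V0 (fun p (_ : p \in rr) => tZ p).
  by exists y.
(* first [y1] off the bad sets, then [y2] off the cones over them with apex [y1] *)
have [y1 [T1y1 By1 Hy1]] := generic T1 W D1 T1x (fun p W0 => codim2_in_hyperplane (Wcodim p W0) W0).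
have nWy1 p : ~ W p y1.
  move=> Wy; apply: (Hy1 p) (Wy); case: Wy => [[Dp1 Dp2 _ _ _] _].
  by case: p Dp1 Dp2 {Hy1} => a b /inr ar /inr br; apply/allpairsP; exists (a, b).
pose Z p := [set z | exists2 t, 0 <= t <= 1 & W p (y1 + t *: (z - y1))].
have thinZ p : in_hyperplane (Z p).
  move=> [z Zz]; have [t _ Wt] := Zz.
  have Wp : W p !=set0 by exists (y1 + t *: (z - y1)).
  by apply: (codim2_cone_in_hyperplane (Wcodim p Wp) (nWy1 p)); exists z.
have [y2 [T2y2 By2 Hy2]] := generic T2 Z D2 T2x thinZ.
pose f t := y1 + t *: (y2 - y1).
have cf : continuous f := @continuous_line R n y1 (y2 - y1).
pose A := \bigcup_(T in [set T | [/\ D T, T x & c T = c T1]]) T.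
pose B := \bigcup_(T in [set T | [/\ D T, T x & c T <> c T1]]) T.
have cA : closed A.
  apply: closed_bigcup => [|T [dT _ _]]; last exact: (DT T dT).1.
  by apply: sub_finite_set fD => T [].
have cB : closed B.
  apply: closed_bigcup => [|T [dT _ _]]; last exact: (DT T dT).1.
  by apply: sub_finite_set fD => T [].
have ABf t : 0 <= t <= 1 -> A (f t) \/ B (f t).
  move=> t01; have [T [dT Tx Tf]] := cover _ (segment_ball t01 By1 By2).
  by have [cT|cT] := pselect (c T = c T1); [left|right]; exists T.
have nAB t : 0 <= t <= 1 -> A (f t) -> ~ B (f t).
  move=> t01 [T [dT Tx cT] Tf] [T' [dT' T'x cT'] T'f].
  apply: (Hy2 (T, T')); first by apply/allpairsP; exists (T, T'); split=> //; exact: inr.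
  by exists t => //; split=> //; split=> //= E; apply: cT'; rewrite -E.
have f0 : f 0 = y1 by rewrite /f scale0r addr0.
have f1 : f 1 = y2 by rewrite /f scale1r addrC subrK.
have I01 (t : R) : t \in `[0, 1] -> 0 <= t <= 1 by rewrite in_itv.
have AI : `[0, 1]%classic `&` f @^-1` A = `[0, 1]%classic.
  apply: (@segment_connected R 0 1).
  - exists 0; split; first by rewrite /= in_itv /= lexx ler01.
    by rewrite /= f0; exists T1.
  - exists (~` (f @^-1` B)).
      by apply: closed_openC; apply: preimage_closed => // t _; exact: cf.
    apply/seteqP; split=> t [/I01 t01 At]; split=> //; first exact: nAB.
    by have [//|Bt] := ABf t t01; have := At Bt.
  - by exists (f @^-1` A) => //; apply: preimage_closed => // t _; exact: cf.
have : (`[0, 1]%classic `&` f @^-1` A) 1 by rewrite AI /= in_itv /= ler01 lexx.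
move=> [_ A1]; apply: (nAB 1 _ A1); first by rewrite ler01 lexx.
by rewrite f1; exists T2 => //; split=> // /esym.
Qed.

End Simplices.

(** * Gluing functions given on closed pieces *)

Section Gluing.
Variables (R : realType) (n : nat) (D : set (set 'rV[R]_n)).
Local Notation E := 'rV[R]_n.
Implicit Types (T : set E) (x y : E) (Q : set E -> E -> R) (g : E -> R).
Hypotheses (finD : finite_set D) (closedD : forall T, D T -> closed T).
Local Notation Omega := (cell_union D).

Lemma exists_glue Q :
  (forall x T1 T2, D T1 -> D T2 -> T1 x -> T2 x -> Q T1 x = Q T2 x) ->
  exists g, forall T x, D T -> T x -> g x = Q T x.
Proof.
move=> QE; exists (fun x => Q (xget set0 [set T | D T /\ T x]) x) => T x DT Tx.
by case: xgetP => [T' _ [? ?]|/(_ T)[]//]; exact: QE.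
Qed.

Lemma glue_continuous Q g : (forall T, D T -> continuous (Q T)) ->
  (forall T x, D T -> T x -> g x = Q T x) -> {within Omega, continuous g}.
Proof.
move=> cQ gQ; apply/subspace_continuousP => x [T0 DT0 T0x].
apply/cvgrPdist_le => e e0; rewrite near_withinE.
have nQ : \forall y \near x, forall T, D T -> `|Q T x - Q T y| <= e.
  apply: (@near_finite E (nbhs x) _ D (fun T y => `|Q T x - Q T y| <= e)
    (nbhs_filter x) finD) => T DT.
  exact: (cvgrPdist_le _ _).1 (cQ T DT x) _ e0.
apply: filterS (filterI nQ (near_mem_closed x finD closedD)) => y [Qy Hy] [T DT Ty].
by have := Qy T DT; rewrite -(gQ T x DT (Hy T DT Ty)) -(gQ T y DT Ty).
Qed.

(** Near [x] each increment of [g] is the increment of one of the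
    finitely many pieces at [x], and these have the same derivative. *)
Lemma glue_is_derive Q g x a (l : R) : Omega° x ->
  (forall T y, D T -> T y -> Omega° y -> g y = Q T y) ->
  (forall T, D T -> T x -> is_derive x a (Q T) l) -> is_derive x a g l.
Proof.
move=> Ox gQ dQ.
suff H : (fun h : R => h^-1 *: ((g \o shift x) (h *: a) - g x)) @ 0^' --> (l : R).
  apply: DeriveDef; first by apply/cvg_ex; eexists; exact: H.
  exact: (cvg_lim (@norm_hausdorff _ _) H).
apply/cvgrPdist_le => e e0.
have nQ : \forall h \near (0 : R)^', forall T, D T ->
    T x -> `|l - h^-1 *: ((Q T \o shift x) (h *: a) - Q T x)| <= e.
  apply: (@near_finite R (0 : R)^' _ D (fun T h => T x ->
    `|l - h^-1 *: ((Q T \o shift x) (h *: a) - Q T x)| <= e) _ finD) => T DT.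
  have [Tx|nTx] := pselect (T x); last by apply: filterE.
  have [d1 d2] := dQ T DT Tx; rewrite -d2.
  have dH : \forall h \near (0 : R)^',
      `|'D_a (Q T) x - h^-1 *: ((Q T \o shift x) (h *: a) - Q T x)| <= e.
    exact: (cvgrPdist_le _ _).1 d1 _ e0.
  by apply: filterS dH => h hh _.
have near0 (B : set E) : nbhs x B -> \forall h \near (0 : R)^', B (h *: a + x).
  move=> nB; apply: nbhs_dnbhs; under eq_fun do rewrite addrC.
  by apply: (@continuous_line R n x a 0); rewrite scale0r addr0.
have nO : nbhs x Omega° by apply: open_nbhs_nbhs; split => //; exact: open_interior.
apply: filterS (filterI nQ (filterI (near0 _ nO) (near0 _ (near_mem_closed x finD closedD)))).
move=> h [Qh [Oh Hh]]; have [T DT Th] := interior_subset Oh.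
have Tx := Hh T DT Th.
by rewrite /= (gQ T _ DT Th Oh) (gQ T x DT Tx Ox); exact: Qh.
Qed.

(** It identifies the continuous extension of a derivative to the
    boundary of a simplex with the derivative of the polynomial piece. *)
Lemma continuous_within_unique (A B : set E) g h x :
  {within A, continuous g} -> continuous h -> B `<=` A ->
  (forall y, B y -> g y = h y) -> A x -> closure B x -> g x = h x.
Proof.
move=> /subspace_continuousP cg ch BA gh Ax Bx.
have FB : ProperFilter (within B (nbhs x)) by exact: within_nbhs_proper.
have g_cvg : g y @[y --> within B (nbhs x)] --> g x.
  by apply: cvg_trans (cg x Ax); apply: cvg_app; exact: within_subset.
have h_cvg : h y @[y --> within B (nbhs x)] --> h x.
  by apply: cvg_trans (ch x); apply: cvg_app; exact: cvg_within.
apply: (cvg_unique (@norm_hausdorff _ _) _ h_cvg); apply: cvg_trans g_cvg.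
apply: near_eq_cvg; rewrite near_withinE.
by apply: filterE => y By; rewrite gh.
Qed.

End Gluing.

(** * Interior cells *)

Section Cell.
Variables (R : realType) (n : nat) (Delta : set (set 'rV[R]_n)) (v : 'rV[R]_n).
Local Notation E := 'rV[R]_n.
Implicit Types (T : set E) (x y u : E) (s : seq 'I_n).
Hypotheses (meshD : is_mesh Delta) (intv : interior_cell Delta v).
Local Notation D := (cell Delta v).
Local Notation Omega := (cell_union D).

Lemma cell_finite : finite_set D.
Proof. by have [fD _ _] := meshD; apply: sub_finite_set fD => T []. Qed.

Lemma cell_simplex T : D T -> is_simplex n T.
Proof. by have [_ sD _] := meshD; move=> [/sD]. Qed.

Lemma cell_closed T : D T -> closed T.
Proof. by move=> /cell_simplex; exact: simplex_closed. Qed.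

Lemma cell_dense T : D T -> T `<=` closure T°.
Proof. by move=> /cell_simplex; exact: simplex_dense_interior. Qed.

Lemma cell_center T : D T -> T v.
Proof. by move=> [_ [p [_ -> [i ->]]]]; exact: vertex_in_hull. Qed.

Lemma cell_segment T x (t : R) : D T -> 0 <= t <= 1 -> T x -> T (v + t *: (x - v)).
Proof.
move=> DT t01 Tx; have := cell_center DT; have [p _ TE] := cell_simplex DT.
by rewrite TE in Tx *; move=> Tv; exact: segment_hull.
Qed.

(** Two simplices of a cell share [v], so their intersection is a
    face; if it is not a facet, it has at most [n - 1] vertices. *)
Lemma cell_pair T1 T2 : D T1 -> D T2 -> T1 <> T2 ->
  common_face n.-1 (T1 `&` T2) T1 T2 \/ in_codim2_hull (T1 `&` T2).
Proof.
move=> D1 D2 T12; have [_ _ H] := meshD; have [D1' _] := D1; have [D2' _] := D2.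
have [E0|[k kn F]] := H T1 T2 D1' D2' T12.
  have : (T1 `&` T2) v by split; exact: cell_center.
  by rewrite E0.
have [kE|kn1] := eqVneq k n.-1; first by left; rewrite -kE.
have k2 : (k.+1 < n)%N.
  have : k != n.-1 by []; case: (n) kn => //= m; rewrite ltnS leq_eqVlt.
  by move=> /orP[/eqP ->|//]; rewrite eqxx.
right; have [[p [_ _ [q _ FE]]] _] := F; exists k, (p \o q).
by rewrite -FE; split.
Qed.

Lemma near_segment (O : set E) u : nbhs v O ->
  exists2 e : R, 0 < e <= 1 & forall t, 0 <= t < e -> O (v + t *: u).
Proof.
move=> nO; have cl : \forall t \near (0 : R), O (v + t *: u).
  by apply: (@continuous_line R n v u 0); rewrite scale0r addr0.
have /nbhs_ballP[e /= e0 He] := cl.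
exists (Num.min e 1); first by rewrite lt_min e0 ltr01 ge_min lexx orbT.
move=> t /andP[t0]; rewrite lt_min => /andP[te _]; apply: He.
by rewrite -ball_normE /= sub0r normrN ger0_norm.
Qed.

Lemma agree_interior (Q : set E -> E -> R) :
  (forall T1 T2, D T1 -> D T2 -> common_face n.-1 (T1 `&` T2) T1 T2 ->
     forall x, (T1 `&` T2) x -> Q T1 x = Q T2 x) ->
  forall x T1 T2, Omega° x -> D T1 -> D T2 -> T1 x -> T2 x -> Q T1 x = Q T2 x.
Proof.
move=> HQ x T1 T2 Ox; apply: (@facet_connected R n D (fun T => Q T x) x) => //.
- exact: cell_finite.
- by move=> T DT; split; [exact: cell_closed|exact: cell_dense].
- move=> {}T1 {}T2 D1 D2 T1x T2x Q12.
  have [T12|T12] := pselect (T1 = T2); first by case: Q12; rewrite T12.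
  have [F|//] := cell_pair D1 D2 T12.
  by case: Q12; exact: HQ.
Qed.

(** The point [x] may lie on the boundary of the union, where
    [facet_connected] does not apply.  The points of the segment from [v] to [x]
    that are close to [v] are interior, and they determine the values at [x]. *)
Lemma agree_everywhere (P : set E -> E -> R) d s :
  (forall T, D T -> polys d (P T)) ->
  (forall T1 T2, D T1 -> D T2 -> common_face n.-1 (T1 `&` T2) T1 T2 ->
     forall x, (T1 `&` T2) x -> partials s (P T1) x = partials s (P T2) x) ->
  forall x T1 T2, D T1 -> D T2 -> T1 x -> T2 x ->
    partials s (P T1) x = partials s (P T2) x.
Proof.
move=> pP HP x T1 T2 D1 D2 T1x T2x.
have nO : nbhs v Omega° by apply: open_nbhs_nbhs; split; [exact: open_interior|exact: intv].
have [e /andP[e0 e1] He] := near_segment (x - v) nO.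
have := @polys_eq_germ R n d (P T1) (P T2) v (x - v) s e (pP _ D1) (pP _ D2) e0.
rewrite [v + (x - v)]addrC subrK; apply => t te.
have t01 : 0 <= t <= 1.
  by have /andP[t0 t1] := te; rewrite t0 /= (le_trans (ltW t1)).
apply: (@agree_interior (fun T => partials s (P T)) HP) => //; first exact: He.
  exact: cell_segment.
exact: cell_segment.
Qed.

(** The facet contains the segment from [v] to [x], so the derivatives
    of the two smooth functions in the direction [x - v] agree at [v].  Those of
    order at most [d] are shared by the Taylor polynomials, and those of higher
    order vanish for polynomials of degree at most [d]. *)
Lemma taylor_on_facet U1 U2 f1 f2 (p1 p2 : E -> R) d s T1 T2 x :
  open U1 -> open U2 -> is_Coo U1 f1 -> is_Coo U2 f2 ->
  T1 `<=` U1 -> T2 `<=` U2 -> polys d p1 -> polys d p2 ->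
  (forall s', (size s' <= d)%N -> partials s' p1 v = partials s' f1 v) ->
  (forall s', (size s' <= d)%N -> partials s' p2 v = partials s' f2 v) ->
  D T1 -> D T2 ->
  (forall y, (T1 `&` T2) y -> partials s f1 y = partials s f2 y) ->
  (T1 `&` T2) x -> partials s p1 x = partials s p2 x.
Proof.
move=> oU1 oU2 C1 C2 TU1 TU2 pp1 pp2 j1 j2 D1 D2 E [T1x T2x].
have := @polys_eq_on_line R n d p1 p2 v (x - v) s pp1 pp2 _ 1.
rewrite scale1r [v + (x - v)]addrC subrK; apply => k.
have [kd|dk] := leqP (size s + k) d; last by rewrite !(Dline_polys0 _ _ dk).
rewrite (eq_Dline _ kd j1) (eq_Dline _ kd j2).
have seg t : 0 <= t < 1 -> (T1 `&` T2) (v + t *: (x - v)).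
  by move=> /andP[t0 t1]; split; apply: cell_segment; rewrite // t0 ltW.
have := @Dline_eq_right R n U1 U2 f1 f2 v (x - v) s k 1 oU1 oU2 C1 C2 ltr01 _ _ 0.
rewrite scale0r addr0; apply; last by rewrite lexx ltr01.
  by move=> t /seg[? ?]; split; [exact: TU1|exact: TU2].
by move=> t /seg /E.
Qed.

(** The derivatives of the pieces fit together up to order [r], so the
    derivatives of the glued function are obtained by gluing those of the pieces,
    by induction on the order; gluing over the closed union gives the continuous
    extensions. *)
Lemma glue_Ck_closed (P : set E -> E -> R) (d r : nat) g :
  (forall T, D T -> polys d (P T)) ->
  (forall s, (size s <= r)%N -> forall x T1 T2, D T1 -> D T2 -> T1 x -> T2 x ->
    partials s (P T1) x = partials s (P T2) x) ->
  (forall T x, D T -> T x -> g x = P T x) ->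
  is_Ck_closed r Omega g.
Proof.
move=> pP HP gP.
have CP T : D T -> is_Coo setT (P T) by move=> /pP; exact: is_Coo_polys.
have cP T s : D T -> continuous (partials s (P T)).
  by move=> /CP /is_CooP H x; have [] := H s x I.
have step i s : (size s < r)%N ->
    (forall T y, D T -> T y -> Omega° y -> partials s g y = partials s (P T) y) ->
    forall T x, D T -> T x -> Omega° x ->
    is_derive x (unit_vec R i) (partials s g) (partials (i :: s) (P T) x).
  move=> sr gsP T x DT Tx Ox.
  apply: (glue_is_derive cell_finite cell_closed Ox gsP) => T' DT' T'x.
  rewrite (HP (i :: s) sr x T T')//.
  by have /CP/is_CooP/(_ s x I)[_ /(_ i)] := DT'; exact: derivableP.
have gs s : (size s <= r)%N -> forall T x, D T -> T x -> Omega° x ->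
    partials s g x = partials s (P T) x.
  elim: s => [|i s IH] sr T x DT Tx Ox; first exact: gP.
  by have [_] := step i s sr (IH (ltnW sr)) T x DT Tx Ox.
have ext s : (size s <= r)%N -> exists2 h : E -> R, {within Omega, continuous h} &
    forall T x, D T -> T x -> h x = partials s (P T) x.
  move=> sr; have [h hE] := exists_glue (HP s sr); exists h => //.
  exact: (glue_continuous cell_finite cell_closed (fun T DT => cP T s DT)).
have gh s h : (size s <= r)%N -> (forall T x, D T -> T x -> h x = partials s (P T) x) ->
    forall x, Omega° x -> h x = partials s g x.
  move=> sr hE x Ox; have [T DT Tx] := interior_subset Ox.
  by rewrite (gs s sr T)//; exact: hE.
split.
- exact: (glue_continuous cell_finite cell_closed (fun T DT => cP T [::] DT)).
- move=> s sr x Ox; have [T DT Tx] := interior_subset Ox; split; last first.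
    by move=> ltsr i; have [] := step i s ltsr (gs s sr) T x DT Tx Ox.
  have [h ch hE] := ext s sr.
  have := (subspace_continuousP _ _).1 ch x (interior_subset Ox).
  rewrite within_interior//.
  move=> {}ch; suff H : partials s g @ x --> h x.
    by have := H; rewrite (gh s h sr hE x Ox).
  have nO : \forall y \near x, Omega° y.
    by apply: open_nbhs_nbhs; split => //; exact: open_interior.
  have nE : \forall y \near x, h y = partials s g y.
    by apply: filterS nO => y Oy; exact: gh s h sr hE y Oy.
  exact: cvg_trans (@near_eq_cvg _ _ (nbhs x) (nbhs_filter x) h _ nE) ch.
- move=> al alr; have sr : (size (flatten [seq nseq (al i) i | i <- enum 'I_n]) <= r)%N.
    by rewrite size_Dmulti.
  have [h ch hE] := ext _ sr; exists h => // x Ox; exact: gh hE x Ox.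
Qed.

End Cell.

(** * The two implications *)

(** Any segment that starts in the open set begins with a piece inside
    it. *)
Lemma polys_eq_open (R : realType) (n d : nat) (f1 f2 : 'rV[R]_n -> R) (B : set 'rV[R]_n) :
  polys d f1 -> polys d f2 -> open B -> B !=set0 ->
  (forall x, B x -> f1 x = f2 x) -> f1 = f2.
Proof.
move=> pf1 pf2 oB [x Bx] E; apply/funext => y.
have nB : nbhs x B by apply: open_nbhs_nbhs.
have [e /andP[e0 _] He] := near_segment (y - x) nB.
have := @polys_eq_germ R n d f1 f2 x (y - x) [::] e pf1 pf2 e0.
by rewrite [x + _]addrC subrK; apply => t te; exact: E (He t te).
Qed.

Section Main.
Variables (R : realType) (n : nat) (Delta : set (set 'rV[R]_n)) (v : 'rV[R]_n).
Variables (r rho : nat).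
Local Notation E := 'rV[R]_n.
Implicit Types (T : set E) (x y u : E) (s : seq 'I_n).
Hypotheses (meshD : is_mesh Delta) (vertv : mesh_vertex Delta v).
Hypotheses (intv : interior_cell Delta v).
Local Notation D := (cell Delta v).
Local Notation Omega := (cell_union D).

Lemma polys_sub_poly_splines : polys_on Omega rho `<=` poly_splines D r rho.
Proof.
move=> g [p pp gp]; split.
  apply: (glue_Ck_closed meshD (P := fun=> p) (d := rho)) => // T x DT Tx.
  by apply: gp; exists T.
by move=> T DT; exists p => // x Tx; apply: gp; exists T.
Qed.

(** The polynomial pieces of a spline are smooth on the whole space
    and so form a member of S^r. *)
Lemma Sr_sub_Crho_degenerate :
  splines_Sr D r `<=` splines_Crho D v rho -> degenerate D r rho.
Proof.
move=> H; apply/seteqP; split; last exact: polys_sub_poly_splines.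
move=> g [[_ _ extg] pg].
have [q Hq] : exists q : set E -> E -> R, forall T, D T ->
    polys rho (q T) /\ forall x, T x -> g x = q T x.
  have /choice[q Hq] : forall T, exists p : E -> R, D T ->
      polys rho p /\ forall x, T x -> g x = p x.
    move=> T; have [DT|nDT] := pselect (D T); last by exists (fun=> 0).
    by have [p pp gp] := pg T DT; exists p.
  by exists q.
have Cq T : D T -> is_Coo setT (q T) by move=> /Hq[+ _]; exact: is_Coo_polys.
pose sigma T := Piece setT (q T).
have Ssigma : splines D sigma.
  by move=> T DT; split; [exact: openT|exact: subsetT|exact: Cq].
have qext al x T (h : E -> R) : (mdeg al <= r)%N -> D T -> T x ->
    {within Omega, continuous h} -> (forall y, Omega° y -> h y = Dmulti al g y) ->
    h x = Dmulti al (q T) x.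
  move=> alr DT Tx ch hE.
  apply: (@continuous_within_unique R n Omega T° h) => //.
  - move=> y; have /is_CooP := Cq T DT.
    by move=> /(_ (flatten [seq nseq (al i) i | i <- enum 'I_n]) y I)[].
  - by move=> y /interior_subset Ty; exists T.
  - move=> y Ty; rewrite hE.
      apply: (@eq_partials R n T°) Ty; first exact: open_interior.
      by move=> z /interior_subset; exact: (Hq T DT).2.
    by apply: interiorS Ty => z Tz; exists T.
  - by exists T.
  - exact: (cell_dense meshD DT).
have /H [_ Cr] : splines_Sr D r sigma.
  split=> // T1 T2 D1 D2 _ al alr x [T1x T2x].
  have [h ch hE] := extg al alr.
  by rewrite -(qext al x T1 h) // -(qext al x T2 h).
have [T0 DT0 vT0] := vertv; have D0 : D T0 by [].
exists (q T0); first exact: (Hq T0 D0).1.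
move=> x [T DT Tx]; rewrite ((Hq T DT).2 x Tx).
suff -> : q T = q T0 by [].
apply: (polys_eq_jet (x := v) (Hq T DT).1 (Hq T0 D0).1) => s srho.
rewrite (partialsE s openT (Cq T DT) I) (partialsE s openT (Cq T0 D0) I).
by apply: Cr => //; rewrite mdeg_multi_index.
Qed.

(** The Taylor polynomials of the pieces of a member of S^r are glued
    to a polynomial spline of class C^r. *)
Lemma degenerate_Sr_sub_Crho : (r <= rho)%N ->
  degenerate D r rho -> splines_Sr D r `<=` splines_Crho D v rho.
Proof.
move=> rrho deg sigma [Ssigma Csigma]; split=> //.
pose U T := piece_dom (sigma T); pose f T := piece_fun (sigma T).
have oU T : D T -> open (U T) by move=> /Ssigma[].
have TU T : D T -> T `<=` U T by move=> /Ssigma[].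
have Cf T : D T -> is_Coo (U T) (f T) by move=> /Ssigma[].
have /choice[p Hp] T : exists p : E -> R, polys rho p /\
    forall al, (mdeg al <= rho)%N -> Dmulti al p v = Dmulti al (f T) v.
  by have [p ? ?] := taylor_polys rho (fun al => Dmulti al (f T) v) v; exists p.
have jet T s : D T -> (size s <= rho)%N -> partials s (p T) v = partials s (f T) v.
  move=> DT srho; rewrite (partialsE s openT (is_Coo_polys (Hp T).1) I).
  rewrite (partialsE s (oU T DT) (Cf T DT)); last exact: TU (cell_center DT).
  by apply: (Hp T).2; rewrite mdeg_multi_index.
have agree s : (size s <= r)%N -> forall x T1 T2, D T1 -> D T2 -> T1 x -> T2 x ->
    partials s (p T1) x = partials s (p T2) x.
  move=> sr; apply: (agree_everywhere meshD intv (d := rho)).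
    by move=> T _; exact: (Hp T).1.
  move=> T1 T2 D1 D2 F x; apply: (taylor_on_facet meshD (oU T1 D1) (oU T2 D2)
    (Cf T1 D1) (Cf T2 D2) (TU T1 D1) (TU T2 D2) (Hp T1).1 (Hp T2).1
    (fun s' => jet T1 s' D1) (fun s' => jet T2 s' D2) D1 D2) => y [T1y T2y].
  rewrite (partialsE s (oU T1 D1) (Cf T1 D1) (TU T1 D1 y T1y)).
  rewrite (partialsE s (oU T2 D2) (Cf T2 D2) (TU T2 D2 y T2y)).
  by apply: Csigma => //; rewrite mdeg_multi_index.
have [g gp] := exists_glue (agree [::] (leq0n r)).
have : poly_splines D r rho g.
  split; first by apply: (glue_Ck_closed meshD (P := p) (d := rho)) => // T _; exact: (Hp T).1.
  by move=> T DT; exists (p T); [exact: (Hp T).1|move=> x Tx; exact: gp].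
rewrite deg => -[p0 pp0 gp0].
have pE T : D T -> p T = p0.
  move=> DT; apply: (polys_eq_open (B := T°) (Hp T).1 pp0); first exact: open_interior.
    have [y [Ty _]] := cell_dense meshD DT (cell_center DT) filterT.
    by exists y.
  move=> x /interior_subset Tx; rewrite -gp0; last by exists T.
  by apply/esym; exact: gp.
move=> T1 T2 D1 D2 al alrho.
by rewrite -(Hp T1).2// -(Hp T2).2// !pE.
Qed.

End Main.

Theorem theorem1 (R : realType) (n : nat) (Delta : set (set 'rV[R]_n))
    (v : 'rV[R]_n) (r rho : nat) :
  (1 <= n)%N ->
  is_mesh Delta ->
  mesh_vertex Delta v ->
  interior_cell Delta v ->
  (r <= rho)%N ->
  (splines_Sr (cell Delta v) r `<=` splines_Crho (cell Delta v) v rho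
   <-> degenerate (cell Delta v) r rho).
Proof.
move=> _ meshD vertv intv rrho; split; first exact: Sr_sub_Crho_degenerate.
exact: degenerate_Sr_sub_Crho.
Qed.
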